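(* Let $\Psi$ be a context of parameters with positive types and $M$ a simple linear pattern with $\Psi\vdash M\Uparrow A$. If $\Psi\vdash\mathrm{Not}(M)\Rightarrow N:A$, then $N$ is a simple linear pattern and $\Psi\vdash N\Uparrow A$.
   Context: Strict $\lambda$-calculus: labels $k\in\{1,0,u\}$; types $A::=a\mid A_1\to^kA_2$; terms $c\mid x\mid\lambda x^k{:}A.M\mid M_1M_2^k$, over a signature $\Sigma$. Positive types $P::=a\mid N\to^1P$, negative types $N::=a\mid P\to^uN$; constants of $\Sigma$ and parameters in $\Psi$ have positive types. Existential variables are a separate syntactic class. For $\Psi=x_1{:}A_1,\dots,x_n{:}A_n$ (fixed standard order) a label sequence is $\Phi=x_1^{k_1}\dots x_n^{k_n}$, $\Phi(x_i)=k_i$; $\Psi^u$ has all labels $u$. A generalized variable over $\Psi$ at atomic type $a$ is $E\,\Phi$ with $E$ of type $A_1\to^{k_1}\cdots A_n\to^{k_n}a$. Simple patterns $\Psi\vdash M\Uparrow A$: if $(\Psi,x{:}P)\vdash M\Uparrow B$ then $\Psi\vdash\lambda x^u{:}P.M\Uparrow P\to^uB$; if $h$ is a constant of $\Sigma$ or a variable of $\Psi$ of type $A_1\to^1\cdots\to^1A_n\to^1a$ and $\Psi\vdash M_i\Uparrow A_i$ for all $i$ then $\Psi\vdash h\,M_1^1\dots M_n^1\Uparrow a$; $\Psi\vdash E\,\Phi\Uparrow a$ for a generalized variable over $\Psi$. Linear: no existential variable occurs twice. Convention: for fresh $Z$, $Z\,\Phi$ at non-atomic type $B_1\to^u\cdots\to^uB_m\to^ua$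 stands for $\lambda y_1^u{:}B_1\dots\lambda y_m^u{:}B_m.Z\,\Phi\,y_1^u\dots y_m^u$. Complement: $\mathrm{Not}(1)=0$, $\mathrm{Not}(0)=1$, $\mathrm{Not}(u)=u$; if $\Phi(x_i)\in\{0,1\}$, $\mathrm{Not}_i(\Phi)$ gives $x_i$ label $\mathrm{Not}(\Phi(x_i))$ and all others label $u$ (undefined if $\Phi(x_i)=u$). $\Psi\vdash\mathrm{Not}(M)\Rightarrow N:A$ is defined by ($Z$'s fresh): if $\mathrm{Not}_i(\Phi)$ defined then $\Psi\vdash\mathrm{Not}(E\,\Phi)\Rightarrow Z\,\mathrm{Not}_i(\Phi):a$; if $(\Psi,x{:}A)\vdash\mathrm{Not}(M)\Rightarrow N:B$ then $\Psi\vdash\mathrm{Not}(\lambda x^u{:}A.M)\Rightarrow\lambda x^u{:}A.N:A\to^uB$; for $h\in\mathrm{dom}(\Sigma\cup\Psi)$ of type $A_1\to^1\cdots\to^1A_n\to^1a$: if $g\in\mathrm{dom}(\Sigma\cup\Psi)$, $g{:}A'_1\to^1\cdots\to^1A'_m\to^1a$, $g\ne h$, then $\Psi\vdash\mathrm{Not}(h\,M_1^1\dots M_n^1)\Rightarrow g\,(Z_1\Psi^u)^1\dots(Z_m\Psi^u)^1:a$; if $\Psi\vdash\mathrm{Not}(M_i)\Rightarrow N:A_i$ then $\Psi\vdash\mathrm{Not}(h\,M_1^1\dots M_n^1)\Rightarrow h\,(Z_1\Psi^u)^1\dots(Z_{i-1}\Psi^u)^1N^1(Z_{i+1}\Psi^u)^1\dots(Z_n\Psi^u)^1:a$.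 *)

(* Defs.v *)
From HB Require Import structures.
From mathcomp Require Import all_boot.
From Stdlib Require List.
Set Implicit Arguments.
Unset Strict Implicit.
Unset Printing Implicit Defensive.

Inductive label := L1 | L0 | Lu.

Definition label_eqb (k l : label) : bool :=
  match k, l with L1, L1 | L0, L0 | Lu, Lu => true | _, _ => false end.

Lemma label_eqP : Equality.axiom label_eqb.
Proof. by case=> [] []; constructor. Qed.

HB.instance Definition _ := hasDecEq.Build label label_eqP.

Section Types.
Variable atom : eqType.

(* [Arr A k B] is A ->^k B. *)
Inductive ty := Atom of atom | Arr of ty & label & ty.

Fixpoint ty_eqb (A B : ty) : bool :=
  match A, B with
  | Atom a, Atom b => a == b
  | Arr A1 k A2, Arr B1 l B2 => [&& ty_eqb A1 B1, k == l & ty_eqb A2 B2]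
  | _, _ => false
  end.

Lemma ty_eqP : Equality.axiom ty_eqb.
Proof.
move=> A B; apply: (iffP idP) => [|<-{B}].
  elim: A B => [a|A1 IH1 k A2 IH2] [b|B1 l B2] //=; first by move/eqP->.
  by case/and3P=> /IH1-> /eqP-> /IH2->.
by elim: A => [a|A1 /= -> k A2 ->] /=; rewrite eqxx.
Qed.

HB.instance Definition _ := hasDecEq.Build ty ty_eqP.

Fixpoint positive (A : ty) : bool :=
  match A with
  | Atom _ => true
  | Arr A1 k A2 => [&& k == L1, negative A1 & positive A2]
  end
with negative (A : ty) : bool :=
  match A with
  | Atom _ => true
  | Arr A1 k A2 => [&& k == Lu, positive A1 & negative A2]
  end.

(* A_1 ->^1 ... ->^1 A_n ->^1 a *)
Definition arrows1 (As : seq ty) (a : atom) : ty :=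
  foldr (fun A B => Arr A L1 B) (Atom a) As.

(* Variables are de Bruijn indices, so a context x_1:A_1, ..., x_n:A_n is the
   list [:: A_n; ...; A_1] and a label sequence x_1^{k_1} ... x_n^{k_n} over it
   is the list [:: k_n; ...; k_1]. *)
Definition ctx := seq ty.
Definition labels := seq label.

Definition ulabels (Psi : ctx) : labels := nseq (size Psi) Lu.

(* A_1 ->^{k_1} ... A_n ->^{k_n} B *)
Definition gtype (Psi : ctx) (Phi : labels) (B : ty) : ty :=
  foldl (fun C Ak => Arr Ak.1 Ak.2 C) B (zip Psi Phi).

(* Existential variables carry their type; there are infinitely many of them
   at every type. *)
Definition evar : Type := (nat * ty)%type.
Definition etype (E : evar) : ty := E.2.

End Types.

Section Terms.
Variables atom con : eqType.
Local Notation ty := (ty atom).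
Local Notation ctx := (ctx atom).
Local Notation evar := (evar atom).

(* [App M1 M2 k] is M1 M2^k. *)
Inductive tm :=
  | Const of con
  | Var of nat
  | EVar of evar
  | Lam of label & ty & tm
  | App of tm & tm & label.

Fixpoint evars (M : tm) : seq evar :=
  match M with
  | Const _ | Var _ => [::]
  | EVar E => [:: E]
  | Lam _ _ M1 => evars M1
  | App M1 M2 _ => evars M1 ++ evars M2
  end.

Definition linear (M : tm) : Prop := uniq (evars M).

(* h M_1^1 ... M_n^1 *)
Definition spine1 (h : tm) (Ms : seq tm) : tm :=
  foldl (fun M1 M2 => App M1 M2 L1) h Ms.

(* E x_1^{k_1} ... x_n^{k_n}, where x_i has index n - i. *)
Definition gapp (E : evar) (Phi : labels) : tm :=
  foldr (fun xk M => App M (Var xk.1) xk.2) (EVar E)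
        (zip (iota 0 (size Phi)) Phi).

Definition gvar (Psi : ctx) (E : evar) (Phi : labels) (a : atom) : Prop :=
  size Phi = size Psi /\ etype E = gtype Psi Phi (Atom a).

(* Z Phi at an arbitrary type B: for B = B_1 ->^u ... ->^u B_m ->^u a this is
   \y_1^u:B_1 ... \y_m^u:B_m. Z Phi y_1^u ... y_m^u, so that over a context Psi
   the type of Z is [gtype Psi Phi B]. *)
Fixpoint eta_gapp (Z : evar) (Phi : labels) (B : ty) : tm :=
  match B with
  | Atom _ => gapp Z Phi
  | Arr B1 k B2 => Lam k B1 (eta_gapp Z (k :: Phi) B2)
  end.

Definition signature := seq (con * ty).

Definition wf_signature (Sigma : signature) : bool :=
  uniq (unzip1 Sigma) && all (@positive atom) (unzip2 Sigma).

Definition wf_ctx (Psi : ctx) : bool := all (@positive atom) Psi.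

Inductive head (Sigma : signature) (Psi : ctx) : tm -> ty -> Prop :=
  | head_const c A : (c, A) \in Sigma -> head Sigma Psi (Const c) A
  | head_var x A : onth Psi x = Some A -> head Sigma Psi (Var x) A.

(* Psi |- M ⇑ A *)
Inductive pattern (Sigma : signature) : ctx -> tm -> ty -> Prop :=
  | pattern_lam Psi P M B :
      positive P ->
      pattern Sigma (P :: Psi) M B ->
      pattern Sigma Psi (Lam Lu P M) (Arr P Lu B)
  | pattern_spine Psi h As a Ms :
      head Sigma Psi h (arrows1 As a) ->
      List.Forall2 (pattern Sigma Psi) Ms As ->
      pattern Sigma Psi (spine1 h Ms) (Atom a)
  | pattern_gvar Psi E Phi a :
      gvar Psi E Phi a ->
      pattern Sigma Psi (gapp E Phi) (Atom a).

Definition not_label (k : label) : label :=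
  match k with L1 => L0 | L0 => L1 | Lu => Lu end.

(* [None] also covers positions outside Phi. *)
Definition not_at (i : nat) (Phi : labels) : option labels :=
  let k := nth Lu Phi i in
  if k == Lu then None
  else Some (set_nth Lu (nseq (size Phi) Lu) i (not_label k)).

Definition fresh (Zs s : seq evar) : bool := all (fun Z => Z \notin s) Zs.

(* The arguments Z_1 Psi^u, ..., Z_m Psi^u at types B_1, ..., B_m. *)
Definition gargs (Psi : ctx) (Zs : seq evar) (Bs : seq ty) : seq tm :=
  [seq eta_gapp ZB.1 (ulabels Psi) ZB.2 | ZB <- zip Zs Bs].

Definition gargs_typed (Psi : ctx) (Zs : seq evar) (Bs : seq ty) : Prop :=
  [seq etype Z | Z <- Zs] = [seq gtype Psi (ulabels Psi) B | B <- Bs].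

(* Psi |- Not(M) => N : A.  Freshness: the variables introduced in a derivation
   are pairwise distinct and do not occur in the term being complemented. *)
Inductive compl (Sigma : signature) : ctx -> tm -> tm -> ty -> Prop :=
  | compl_gvar Psi E Phi a i Phi' Z :
      gvar Psi E Phi a ->
      not_at i Phi = Some Phi' ->
      gvar Psi Z Phi' a ->
      Z != E ->
      compl Sigma Psi (gapp E Phi) (gapp Z Phi') (Atom a)
  | compl_lam Psi A M N B :
      compl Sigma (A :: Psi) M N B ->
      compl Sigma Psi (Lam Lu A M) (Lam Lu A N) (Arr A Lu B)
  | compl_head Psi h As a Ms g Bs Zs :
      head Sigma Psi h (arrows1 As a) ->
      size Ms = size As ->
      head Sigma Psi g (arrows1 Bs a) ->
      g <> h ->
      gargs_typed Psi Zs Bs ->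
      uniq Zs ->
      fresh Zs (evars (spine1 h Ms)) ->
      compl Sigma Psi (spine1 h Ms) (spine1 g (gargs Psi Zs Bs)) (Atom a)
  | compl_arg Psi h As1 A As2 a Ms1 M Ms2 N Zs1 Zs2 :
      head Sigma Psi h (arrows1 (As1 ++ A :: As2) a) ->
      size Ms1 = size As1 ->
      size Ms2 = size As2 ->
      compl Sigma Psi M N A ->
      gargs_typed Psi Zs1 As1 ->
      gargs_typed Psi Zs2 As2 ->
      uniq (Zs1 ++ Zs2) ->
      fresh (Zs1 ++ Zs2) (evars N) ->
      fresh (Zs1 ++ Zs2 ++ evars N) (evars (spine1 h (Ms1 ++ M :: Ms2))) ->
      compl Sigma Psi (spine1 h (Ms1 ++ M :: Ms2))
        (spine1 h (gargs Psi Zs1 As1 ++ N :: gargs Psi Zs2 As2)) (Atom a).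

End Terms.

(* Main.v *)
Require Import Defs.
From mathcomp Require Import all_boot.

(** A pattern has a negative type, and the argument types of a head are
    negative because heads have positive types.  Hence every [Z Psi^u] created
    by the complement is a pattern: eta-expanding at a negative type only
    abstracts over variables of positive type with label [u].  By induction on
    the complement derivation, the existential variables of [N] are exactly the
    fresh ones introduced, so linearity follows from the freshness conditions
    alone. *)

Set Implicit Arguments.
Unset Strict Implicit.
Unset Printing Implicit Defensive.

Section Complement.

Variables (atom con : eqType) (Sigma : signature atom con).
Implicit Types (Psi : ctx atom) (M N h : tm atom con) (A B : ty atom).
Implicit Types (Z E : evar atom) (As : seq (ty atom)) (Phi : labels).

(** Only abstraction yields a non-atomic type, and it demands label [u] and a positive domain. *)
Lemma pattern_negative Psi M A : pattern Sigma Psi M A -> negative A.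
Proof. by elim=> //= {}Psi P {}M B ->. Qed.

Lemma positive_arrows1 As a :
  positive (arrows1 As a) = all (@negative atom) As.
Proof. by elim: As => //= A As ->. Qed.

Lemma head_negative Psi h As a :
  wf_signature Sigma -> wf_ctx Psi -> Defs.head Sigma Psi h (arrows1 As a) ->
  all (@negative atom) As.
Proof.
move=> /andP[_ /allP SigmaP] wfPsi hP; rewrite -(positive_arrows1 As a).
case: hP => [c A cA | x A xA]; first by apply: SigmaP; apply: (map_f snd cA).
elim: Psi x wfPsi xA => [|B Psi IH] [|x] //= /andP[Bpos /IH].
  by move=> _ [<-].
by move=> /[apply].
Qed.

Lemma evars_head Psi h A : Defs.head Sigma Psi h A -> evars h = [::].
Proof. by case. Qed.

Lemma evars_gapp E Phi : evars (gapp con E Phi) = [:: E].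
Proof. by rewrite /gapp; elim: (zip _ _) => //= xk s ->. Qed.

Lemma evars_eta_gapp Z Phi B : evars (eta_gapp con Z Phi B) = [:: Z].
Proof. by elim: B Phi => /= *; rewrite ?evars_gapp. Qed.

Lemma evars_spine1 h (Ms : seq (tm atom con)) :
  evars (spine1 h Ms) = evars h ++ flatten [seq evars M | M <- Ms].
Proof.
by elim: Ms h => [|M Ms IH] h /=; rewrite ?cats0 // [LHS]IH /= catA.
Qed.

Lemma gargs_typed_size Psi Zs Bs : gargs_typed Psi Zs Bs -> size Zs = size Bs.
Proof. by move=> /(congr1 size); rewrite !size_map. Qed.

(** [gargs_typed] forces equal lengths, so [zip] drops no variable. *)
Lemma evars_gargs Psi Zs Bs :
  gargs_typed Psi Zs Bs ->
  flatten [seq evars M | M <- gargs con Psi Zs Bs] = Zs.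
Proof.
move=> /gargs_typed_size; elim: Zs Bs => [|Z Zs IH] [|B Bs] //= [/IH].
by rewrite /gargs /= evars_eta_gapp /= => ->.
Qed.

Lemma pattern_eta_gapp Psi Z Phi B :
  negative B -> size Phi = size Psi -> etype Z = gtype Psi Phi B ->
  pattern Sigma Psi (eta_gapp con Z Phi B) B.
Proof.
elim: B Psi Phi => [a | B1 _ k B2 IH] Psi Phi /=.
  by move=> _ sz tyZ; apply: pattern_gvar.
move=> /and3P[/eqP-> posB1 negB2] sz tyZ; apply: pattern_lam => //.
(* [gtype (B1 :: Psi) (Lu :: Phi) B2] computes to [gtype Psi Phi (Arr B1 Lu B2)], so [Z] keeps its
   type under the binder. *)
by apply: IH => //=; rewrite sz.
Qed.

Lemma pattern_gargs Psi Zs Bs :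
  all (@negative atom) Bs -> gargs_typed Psi Zs Bs ->
  List.Forall2 (pattern Sigma Psi) (gargs con Psi Zs Bs) Bs.
Proof.
elim: Zs Bs => [|Z Zs IH] [|B Bs] //= /andP[negB negBs] [tyZ tyZs].
constructor; last exact: IH.
by apply: pattern_eta_gapp; rewrite ?size_nseq.
Qed.

Lemma compl_linear Psi M N A : compl Sigma Psi M N A -> linear N.
Proof.
rewrite /linear; elim=> // {M N A}Psi.
- by move=> E Phi a i Phi' Z *; rewrite evars_gapp.
- move=> h As a Ms g Bs Zs _ _ hd_g _ tyZs uniqZs _.
  by rewrite evars_spine1 (evars_head hd_g) evars_gargs.
move=> h As1 A As2 a Ms1 M Ms2 N Zs1 Zs2 hd_h _ _ _ uniqN ty1 ty2 uniqZs frZs _.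
rewrite evars_spine1 (evars_head hd_h) map_cat flatten_cat /= !evars_gargs //.
(* With [evars N] moved to the front, what remains is its disjointness from [Zs1 ++ Zs2], which is
   [frZs]. *)
by rewrite uniq_catCA cat_uniq uniqN uniqZs andbT -all_predC.
Qed.

(** Negativity of [A] travels with [wf_ctx Psi] through the induction: at a binder it gives the
    positive domain that keeps the extended context well-formed. *)
Lemma compl_pattern Psi M N A :
  wf_signature Sigma -> wf_ctx Psi -> negative A -> compl Sigma Psi M N A ->
  pattern Sigma Psi N A.
Proof.
move=> wfSigma wfPsi negA MN.
elim: MN wfPsi negA => {M N A}Psi.
- by move=> E Phi a i Phi' Z _ _ gvZ _ _ _; apply: pattern_gvar.
- move=> A M N B _ IH wfPsi /= /andP[posA negB].
  by apply: pattern_lam => //; apply: IH => //=; rewrite /wf_ctx /= posA.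
- move=> h As a Ms g Bs Zs _ _ hd_g _ tyZs _ _ wfPsi _.
  apply: (pattern_spine hd_g); apply: pattern_gargs => //.
  exact: head_negative hd_g.
move=> h As1 A As2 a Ms1 M Ms2 N Zs1 Zs2 hd_h _ _ _ IH ty1 ty2 _ _ _ wfPsi _.
have := head_negative wfSigma wfPsi hd_h.
(* [negA] feeds the induction hypothesis for [N]; [neg1] and [neg2] serve the fresh arguments around
   it. *)
rewrite all_cat /= => /and3P[neg1 negA neg2].
apply: (pattern_spine hd_h); apply: List.Forall2_app; first exact: pattern_gargs.
by constructor; [apply: IH | apply: pattern_gargs].
Qed.

End Complement.

Theorem theorem6p8 (atom con : eqType) (Sigma : signature atom con)
    (Psi : ctx atom) (M N : tm atom con) (A : ty atom) :
  wf_signature Sigma -> wf_ctx Psi ->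
  linear M -> pattern Sigma Psi M A ->
  compl Sigma Psi M N A ->
  linear N /\ pattern Sigma Psi N A.
Proof.
move=> wfSigma wfPsi _ /pattern_negative negA MN.
by split; [apply: compl_linear MN | apply: compl_pattern MN].
Qed.
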